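(* Let $k\ge3$ and $r\ge1$ be integers, let $f:\mathbb{R}^+\to\mathbb{R}$ be a twice differentiable function, let $R:\mathbb{N}\to\mathbb{R}$ be a bounded function satisfying $M_1\le R(n)\le M_2$ for all $n\in\mathbb{N}$, for some two real numbers $M_1$ and $M_2$, and let $\{a(n)\}_{n=1}^\infty\subset\mathbb{N}$ be a strictly increasing sequence satisfying $a(n)=f(n)+R(n)$ for all $n\in\mathbb{N}$. If the inequality $$\limsup_{x\to\infty}|f''(x)|<\Bigl(\frac{k-1}{W(r,k)-1}\Bigr)^2\Bigl(\frac{1}{k-2}-\frac{2(M_2-M_1)}{r}\Bigr)$$ holds, then the graph of $\{a(n)\}_{n=1}^\infty$ contains an arithmetic progression of length $k$.
   Context: $\mathbb{N}=\{1,2,\ldots\}$ and $\mathbb{R}^+=(0,\infty)$. For integers $k\ge3$, $d\ge1$, a sequence $\{p(j)\}_{j=0}^{k-1}\subset\mathbb{N}^d$ is an arithmetic progression (AP) of length $k$ if there is $D\in\mathbb{N}^d$ (so all components of $D$ are positive) with $p(j)=p(0)+jD$ for all $j=0,\ldots,k-1$. The graph of a sequence $\{a(n)\}_{n=1}^\infty\subset\mathbb{N}$ is the set $\{(n,a(n))\in\mathbb{N}^2\mid n\in\mathbb{N}\}$. $W(r,k)$ is the van der Waerden number: the smallest number $N$ such that whenever $\{1,2,\ldots,N\}$ is partitioned into $r$ sets, at least one of these sets contains an AP of length $k$ (so $W(1,k)=k$). *)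

(* Defs.v *)
From mathcomp Require Import all_boot all_order all_algebra.
From mathcomp Require Import all_classical all_reals all_analysis.
From mathcomp Require Import zify.

Set Implicit Arguments.
Unset Strict Implicit.
Unset Printing Implicit Defensive.

Local Open Scope classical_set_scope.

(* Points of N^d are d-tuples. Only the values p 0, ..., p (k - 1) matter. The
   points themselves are not required to be positive here: they are taken in
   a set of points with positive components. *)
Definition is_AP (d k : nat) (p : nat -> d.-tuple nat) : Prop :=
  exists D : d.-tuple nat, (forall i, 0 < tnth D i)%N /\
    forall j, (j < k)%N -> forall i, tnth (p j) i = (tnth (p 0%N) i + j * tnth D i)%N.

Definition contains_AP (d k : nat) (S : set (d.-tuple nat)) : Prop :=
  exists p : nat -> d.-tuple nat,
    is_AP k p /\ forall j, (j < k)%N -> S (p j).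

Definition graph (a : nat -> nat) : set (2.-tuple nat) :=
  [set [tuple n; a n] | n in [set n | (0 < n)%N]].

(* Some of the r sets A i may be empty. *)
Definition vdW_property (r k N : nat) : Prop :=
  forall A : 'I_r -> set nat,
    trivIset setT A ->
    \bigcup_(i in setT) A i = [set n | (1 <= n <= N)%N] ->
    exists i : 'I_r, contains_AP k [set [tuple n] | n in A i].

(* Van der Waerden's theorem, by colour focusing. In the next definition c is
   a colouring of nat. *)
Definition mono_AP (C : finType) (k N : nat) (c : nat -> C) : Prop :=
  exists a D, [/\ (0 < D <= N)%N, (a <= N)%N &
    forall j, (j < k)%N -> c (a + j * D)%N = c a].

(* b is the focus of progressions of length k, one of each colour in S *)
Definition focused (C : finType) (k M b : nat) (S : {set C}) (c : nat -> C) :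
  Prop :=
  forall x, x \in S -> exists a D, [/\ (0 < D <= M)%N, (a + k * D)%N = b &
    forall j, (j < k)%N -> c (a + j * D)%N = x].

Lemma focusing (C : finType) (k : nat) :
  (forall C' : finType, exists N, forall c : nat -> C', mono_AP k N c) ->
  forall s, exists M, forall c : nat -> C, mono_AP k.+1 M c \/
    exists b (S : {set C}), [/\ (b <= M)%N, #|S| = s & focused k M b S c].
Proof.
move=> vdWk; elim=> [|s [M IH]].
  exists 0%N => c; right; exists 0%N, finset.set0.
  by split; [|rewrite cards0|move=> x; rewrite finset.inE].
have [N HN] := vdWk {ffun 'I_M.+1 -> C}.
pose Q := (M + (k.+1 * N) * M.+1)%N.
have leMQ : (M <= Q)%N by rewrite leq_addr.
exists Q.+1 => c.
pose c' t : {ffun 'I_M.+1 -> C} := [ffun i : 'I_M.+1 => c (t * M.+1 + i)%N].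
have [t [E [/andP[E0 EN] tN c't]]] := HN c'.
have blk j i : (j < k)%N -> (i <= M)%N ->
    c (t * M.+1 + i + j * (E * M.+1))%N = c (t * M.+1 + i)%N.
  move=> jk iM; have /ffunP/(_ (inord i)) := c't j jk.
  rewrite !ffunE inordK ?ltnS// => <-; congr c; lia.
have tQ : (t * M.+1 <= N * M.+1)%N by rewrite leq_mul2r tN orbT.
have EQ : (E * M.+1 <= N * M.+1)%N by rewrite leq_mul2r EN orbT.
have kEQ : (k * (E * M.+1) <= k * (N * M.+1))%N by rewrite leq_mul2l EQ orbT.
have Qe : Q = (M + N * M.+1 + k * (N * M.+1))%N by rewrite /Q; lia.
have E0' : (0 < E * M.+1)%N by rewrite muln_gt0 E0.
case: (IH (fun i => c (t * M.+1 + i)%N)) => [[a [D [/andP[D0 DM] aM ca]]]|].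
  left; exists (t * M.+1 + a)%N, D; split; [lia|lia|].
  by move=> j jk; rewrite -addnA; exact: ca.
move=> [b [S [bM Ss Sfoc]]].
have [bS|bS] := boolP (c (t * M.+1 + b)%N \in S).
  have [a [D [/andP[D0 DM] ab ca]]] := Sfoc _ bS.
  left; exists (t * M.+1 + a)%N, D; split; [lia|lia|].
  have caj j : (j < k.+1)%N -> c (t * M.+1 + (a + j * D))%N = c (t * M.+1 + b)%N.
    by rewrite ltnS leq_eqVlt => /predU1P[->|/ca//]; rewrite ab.
  move=> j jk; rewrite -addnA caj//.
  by have := caj 0%N isT; rewrite mul0n addn0.
right; exists (t * M.+1 + b + k * (E * M.+1))%N, (c (t * M.+1 + b)%N |: S)%SET.
split; [lia|by rewrite cardsU1 bS Ss|].
move=> x; rewrite finset.in_setU1 => /predU1P[->|/Sfoc[a [D [/andP[D0 DM] ab ca]]]].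
  exists (t * M.+1 + b)%N, (E * M.+1)%N; split; [lia|by []|].
  by move=> j jk; rewrite blk.
exists (t * M.+1 + a)%N, (D + E * M.+1)%N; split; [lia|by rewrite mulnDr; lia|].
move=> j jk; rewrite -(ca _ jk).
have jD : (j * D <= k * D)%N by rewrite leq_mul2r (ltnW jk) orbT.
rewrite -[RHS](blk j)//; last by lia.
by congr c; rewrite mulnDr; lia.
Qed.

Lemma van_der_Waerden (k : nat) (C : finType) :
  exists N, forall c : nat -> C, mono_AP k N c.
Proof.
elim: k C => [|k IH] C; first by exists 1%N => c; exists 0%N, 1%N; split.
have [M HM] := @focusing C k IH #|C|.
exists M => c; have [//|[b [S [bM /eqP Ss Sfoc]]]] := HM c.
have {Ss}ST : S = [set: C]%SET.
  by apply/eqP; rewrite eqEcard finset.subsetT cardsT (eqP Ss) leqnn.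
have [|a [D [D0M ab ca]]] := Sfoc (c b); first by rewrite ST inE.
have caj j : (j < k.+1)%N -> c (a + j * D)%N = c b.
  by rewrite ltnS leq_eqVlt => /predU1P[->|/ca//]; rewrite ab.
exists a, D; split => //; first by lia.
by move=> j jk; rewrite caj//; have := caj 0%N isT; rewrite mul0n addn0.
Qed.

Lemma vdW_property_ex (r k : nat) : exists N, `[< vdW_property r k N >].
Proof.
have [N HN] := van_der_Waerden k (option 'I_r).
exists (N + k * N).+1; apply/asboolP => A _ Acov.
have [a [D [/andP[D0 DN] aN ca]]] := HN (fun n => [pick i | `[< A i n.+1 >]]).
have inA n : (n <= N + k * N)%N -> exists i, A i n.+1.
  move=> nN; have : [set n | (1 <= n <= (N + k * N).+1)%N] n.+1 by [].
  by rewrite -Acov => -[i _ Ain]; exists i.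
move: ca; case: pickP => [i /asboolP Aia ca|no _]; last first.
  have [i Ai] : exists i, A i a.+1 by apply: inA; lia.
  by have /asboolP := no i.
exists i, (fun j => [tuple (a + j * D).+1]); split.
  exists [tuple D]; split=> [l|j jk l]; rewrite ord1//= !(tnth_nth 0%N)/=.
  by rewrite mul0n addn0.
move=> j jk; exists (a + j * D).+1 => //.
by have := ca j jk; case: pickP => // i' /asboolP Ai' [<-].
Qed.

Definition vdW_number (r k : nat) : nat := ex_minn (vdW_property_ex r k).

(* Main.v *)
Require Import Defs.
From mathcomp Require Import all_boot all_order all_algebra.
From mathcomp Require Import all_classical all_reals all_analysis.
From mathcomp Require Import zify ring lra.
Import Order.TTheory GRing.Theory Num.Theory.
Import numFieldNormedType.Exports.
Local Open Scope classical_set_scope.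
Local Open Scope ring_scope.

(** The idea: an arithmetic progression [n, n + D, ..., n + (k - 1) D] gives one
    in the graph of [a] as soon as the second differences
    [a(n + (j + 2) D) - 2 a(n + (j + 1) D) + a(n + j D)] all vanish, and these
    are integers, so it is enough to make them smaller than 1 in absolute value
    ([second_difference_eq0], [arith_of_second_difference]).

    Each of them splits into a part coming from [f] and a part coming from [R].
    By the mean value theorem applied twice, the first one is [D ^ 2] times a
    value of [f''] ([second_difference_MVT]), so it is small if [D] is. The
    second one is small if [R] hardly varies along the progression: cut
    [[M1, M2]] into [r] cells of length [h = (M2 - M1) / r] and colour [n] by
    the cell of [R n]; on a monochromatic progression the second difference of
    [R] is at most [2 h].

    Let [W] be the van der Waerden number. Any window of [W] consecutive
    integers contains a monochromatic progression of length [k], and that it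
    fits in the window forces [D <= (W - 1) / (k - 1)]
    ([vdW_monochromatic_AP]). Far enough to the right, the assumption on [f'']
    then bounds the second difference of [a] strictly by
    [(1 / (k - 2) - 2 h) + 2 h = 1 / (k - 2) <= 1]. *)

(** * Second differences *)

(** The mean value theorem for [t |-> f (t + h) - f t] on [[x, x + h]] brings
    out a difference of values of [f'] at distance [h], and a second use of the
    theorem, for [f'], concludes. *)
Lemma second_difference_MVT (K : realType) (f : K -> K) (x h : K) :
  0 < h ->
  (forall y, x <= y <= x + 2 * h -> derivable f y 1) ->
  (forall y, x <= y <= x + 2 * h -> derivable (f^`())%classic y 1) ->
  exists2 y, x < y < x + 2 * h &
    f x + f (x + 2 * h) - 2 * f (x + h) = (f^`(2))%classic y * h ^+ 2.
Proof.
move=> h0 df ddf.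
have isf y : x <= y <= x + 2 * h -> is_derive y 1 f ((f^`())%classic y).
  by move=> /df dfy; rewrite derive1E; exact: DeriveDef.
have isdf y : x <= y <= x + 2 * h ->
    is_derive y 1 (f^`())%classic ((f^`(2))%classic y).
  by move=> /ddf dfy; rewrite derive1nS derive1E; exact: DeriveDef.
pose g : K -> K := (f \o shift h) - f.
have isg y : x <= y <= x + h ->
    is_derive y 1 g ((f^`())%classic (y + h) - (f^`())%classic y).
  move=> /andP[xy yxh]; apply: is_deriveB; last by apply: isf; lra.
  rewrite -[X in is_derive _ _ _ X]mulr1.
  have H : is_derive (shift h y) 1 f ((f^`())%classic (y + h)).
    by apply: isf; rewrite /=; lra.
  have sh := @is_derive_shift K y 1 h.
  exact: (@is_derive1_comp K f (shift h) y _ _ H sh).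
have xxh : x < x + h by lra.
have [||c] := @MVT K g (fun y => (f^`())%classic (y + h) - (f^`())%classic y)
    _ _ xxh.
- by move=> y; rewrite in_itv/= => /andP[xy yx]; apply: isg; lra.
- apply: derivable_within_continuous => y; rewrite in_itv/= => yx.
  by have [] := isg y yx.
rewrite in_itv/= => /andP[xc cxh] gE.
have cch : c < c + h by lra.
have [||y] := @MVT K (f^`())%classic (f^`(2))%classic _ _ cch.
- by move=> y; rewrite in_itv/= => /andP[cy yc]; apply: isdf; lra.
- apply: derivable_within_continuous => y; rewrite in_itv/= => /andP[cy yc].
  by apply: ddf; lra.
rewrite in_itv/= => /andP[cy yc] dfE.
exists y; first by lra.
have {}gE : f (x + 2 * h) - f (x + h) - (f (x + h) - f x) =
    (f^`(2))%classic y * h * h.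
  have -> : x + 2 * h = x + h + h by ring.
  by move: gE; rewrite dfE /g !fctE /= !(addrAC _ h (- _)) !subrr !add0r.
by rewrite expr2 mulrA -gE; ring.
Qed.

Lemma second_difference_eq0 (K : realType) (m n p : nat) :
  `|m%:R + n%:R - 2 * p%:R| < 1 :> K -> (m + n = 2 * p)%N.
Proof.
rewrite -natrD -natrM ltr_norml => /andP[d1 d2].
have [lt|lt|//] := ssrnat.ltngtP (m + n)%N (2 * p)%N.
  by exfalso; move: lt; rewrite -(ler_nat K) -natr1; lra.
by exfalso; move: lt; rewrite -(ler_nat K) -natr1; lra.
Qed.

Lemma arith_of_second_difference (k : nat) (u : nat -> nat) :
  (u 0 <= u 1)%N ->
  (forall j, (j.+2 < k)%N -> u j + u j.+2 = 2 * u j.+1)%N ->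
  forall j, (j < k)%N -> (u j = u 0 + j * (u 1 - u 0))%N.
Proof.
move=> u01 u2.
suff H j : ((j < k) -> u j = u 0 + j * (u 1 - u 0))%N /\
    ((j.+1 < k) -> u j.+1 = u 0 + j.+1 * (u 1 - u 0))%N.
  by move=> j; have [] := H j.
elim: j => [|j [IH1 IH2]]; first by split=> _; lia.
split=> // jk; have := u2 j jk; rewrite IH1 ?IH2; lia.
Qed.

(** * Monochromatic progressions *)

Lemma cell_ex (K : realType) (r : nat) (x M h : K) :
  (0 < r)%N -> M <= x <= M + r%:R * h ->
  exists i : 'I_r, M + i%:R * h <= x <= M + i%:R * h + h.
Proof.
case: r => // r _; elim: r => [|r IH] /andP[Mx xr].
  by exists ord0; rewrite mul0r; lra.
have [xr'|rx] := leP x (M + r.+1%:R * h).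
  by have [|i ix] := IH; [rewrite Mx|exists (widen_ord (leqnSn _) i)].
exists ord_max => /=; rewrite (ltW rx)/=.
by move: xr; rewrite -(natr1 r.+1) mulrDl mul1r addrA.
Qed.

(** The colour classes of [{1, ..., W}] form a partition as in the definition of
    [W = vdW_number r k]. The last point [b + (k - 1) D] of the progression that
    it yields is at most [W], which is what bounds [D]. *)
Lemma vdW_monochromatic_AP (r k : nat) (c : nat -> 'I_r) :
  (0 < k)%N ->
  exists b D, [/\ (0 < b)%N, (0 < D)%N, (b + k.-1 * D <= vdW_number r k)%N &
    forall j, (j < k)%N -> c (b + j * D)%N = c b].
Proof.
move=> k0; rewrite /vdW_number; case: ex_minnP => W /asboolP vdW _.
have [||i [p [[D [D0 pD]] pA]]] :=
  vdW (fun i => [set n | (1 <= n <= W)%N /\ c n = i]).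
- apply/trivIsetP => i j _ _ /eqP ij; rewrite -subset0 => n [[_ ci] [_ cj]].
  by apply: ij; rewrite -ci.
- by apply/seteqP; split=> [n [i _ []]//|n nW]; exists (c n).
pose b := tnth (p 0%N) ord0; pose E := tnth D ord0.
have inA j : (j < k)%N -> (1 <= b + j * E <= W)%N /\ c (b + j * E)%N = i.
  by move=> jk; have [n nA pn] := pA j jk; rewrite -pD// -pn.
have [b0 cb] := inA 0%N k0; rewrite mul0n addn0 in b0 cb.
exists b, E; split.
- by case/andP: b0.
- exact: D0.
- by have [|/andP[_ ->]] := inA k.-1; first by rewrite prednK.
- by move=> j /inA[_ ->]; rewrite cb.
Qed.

(** * Arithmetic progressions in the graph *)

Lemma limf_esup_lt_pinfty (K : realType) (g : K -> \bar K) (c : \bar K) :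
  (limf_esup g (pinfty_nbhs K) < c)%E ->
  exists M : K, forall x, M < x -> (g x < c)%E.
Proof.
rewrite limf_esupE => /ereal_inf_lt[_ [A [M [_ MA]] <-] supA].
exists M => x /MA Ax; apply: le_lt_trans supA.
by apply: ereal_sup_ubound; exists x.
Qed.

(** Both components of the difference of a progression have to be positive; for
    the second one this is where [a] being strictly increasing is used. *)
Lemma graph_contains_AP (k : nat) (a : nat -> nat) (n D : nat) :
  (forall m n : nat, (0 < m)%N -> (m < n)%N -> (a m < a n)%N) ->
  (0 < n)%N -> (0 < D)%N ->
  (forall j, (j.+2 < k)%N ->
    a (n + j * D) + a (n + j.+2 * D) = 2 * a (n + j.+1 * D))%N ->
  contains_AP k (graph a).
Proof.
move=> a_incr n0 D0 a2; pose u j := a (n + j * D)%N.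
have u01 : (u 0 < u 1)%N by apply: a_incr; lia.
have uE := @arith_of_second_difference k u (ltnW u01) a2.
exists (fun j => [tuple (n + j * D)%N; u j]); split; last first.
  by move=> j _; exists (n + j * D)%N => //=; rewrite addn_gt0 n0.
exists [tuple D; (u 1 - u 0)%N]; split.
  by case=> -[|[|//]] ?; rewrite !(tnth_nth 0%N)//= subn_gt0.
move=> j jk.
by case=> -[|[|//]] ?; rewrite !(tnth_nth 0%N)/= ?(uE j jk)//; lia.
Qed.

Theorem theoremA2 (K : realType) (k r : nat) (hk : (3 <= k)%N) (hr : (1 <= r)%N)
  (f : K -> K)
  (hf1 : forall x : K, 0 < x -> derivable f x 1)
  (hf2 : forall x : K, 0 < x -> derivable (f^`())%classic x 1)
  (R : nat -> K) (M1 M2 : K)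
  (hR : forall n : nat, (0 < n)%N -> M1 <= R n <= M2)
  (a : nat -> nat)
  (ha_pos : forall n : nat, (0 < n)%N -> (0 < a n)%N)
  (ha_incr : forall m n : nat, (0 < m)%N -> (m < n)%N -> (a m < a n)%N)
  (ha : forall n : nat, (0 < n)%N -> (a n)%:R = f n%:R + R n)
  (hlim : (limf_esup (fun x : K => `|(f^`(2))%classic x|%:E) (pinfty_nbhs K) <
    (((k%:R - 1) / ((vdW_number r k)%:R - 1)) ^+ 2
      * (1 / (k%:R - 2) - 2 * (M2 - M1) / r%:R))%:E)%E) :
  contains_AP k (graph a).
Proof.
have [X fX] := limf_esup_lt_pinfty _ _ _ hlim; clear hlim.
pose q := (k%:R - 1) / ((vdW_number r k)%:R - 1) : K.
pose e := 1 / (k%:R - 2) - 2 * (M2 - M1) / r%:R : K.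
have {}fX x : X < x -> `|(f^`(2))%classic x| < q ^+ 2 * e.
  by move=> /fX; rewrite lte_fin.
pose h := (M2 - M1) / r%:R.
have r0 : 0 < r%:R :> K by rewrite ltr0n.
have rh : r%:R * h = M2 - M1 by rewrite mulrC divfK// gt_eqF.
have cell n : exists i : 'I_r, (0 < n)%N ->
    M1 + i%:R * h <= R n <= M1 + i%:R * h + h.
  have [n0|] := posnP n; first by exists (Ordinal hr); rewrite n0.
  move=> /hR Rn; have [|i iR] := @cell_ex K r (R n) M1 h hr; last by exists i.
  by rewrite rh; lra.
have [col colP] := choice cell.
pose n0 := Num.bound `|X|.
have Xn0 : X < n0%:R.
  by apply: le_lt_trans (ler_norm X) _; apply: archi_boundP.
have [b [D [b0 D0 bDW cD]]] :=
  @vdW_monochromatic_AP r k (fun n => col (n0 + n)%N) (ltnW (ltnW hk)).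
have D0' : 0 < D%:R :> K by rewrite ltr0n.
have W1 : 0 < (vdW_number r k)%:R - 1 :> K.
  rewrite subr_gt0 (ltr_nat K 1); apply: leq_trans bDW.
  by have : (0 < k.-1 * D)%N; [rewrite muln_gt0; lia|lia].
(* [1 / q] is the bound on the step of a progression that fits in the window *)
have Dq : D%:R * q <= 1.
  rewrite /q mulrA ler_pdivrMr// mul1r lerBrDr -(natrB _ (ltnW (ltnW hk))).
  by rewrite -natrM natr1 ler_nat; apply: leq_trans bDW; rewrite subn1; lia.
(* [e > 0] because an absolute value lies below [q ^ 2 * e]; hence replacing
   [D * q] by 1 in [D ^ 2 * q ^ 2 * e] gives an upper bound *)
have q2e : 0 < q ^+ 2 * e.
  by apply: le_lt_trans (fX (X + 1) _) => //; lra.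
have e0 : 0 < e.
  rewrite ltNge; apply: contraTN q2e => e0.
  by rewrite -leNgt mulr_ge0_le0// sqr_ge0.
have q0 : 0 <= q.
  by rewrite divr_ge0 ?(ltW W1)// subr_ge0 (ler_nat K 1); lia.
have De : D%:R ^+ 2 * (q ^+ 2 * e) <= e.
  by rewrite mulrA -exprMn ler_piMl ?(ltW e0)// exprn_ile1// mulr_ge0//.
have e1 : e + 2 * h <= 1.
  have -> : e + 2 * h = (k%:R - 2)^-1 by rewrite /e /h mulrA subrK div1r.
  by rewrite invf_le1 ?lerBrDr ?subr_gt0 ?(ltr_nat K 2)// (ler_nat K 3).
have nb0 : (0 < n0 + b)%N by rewrite addn_gt0 b0 orbT.
apply: (graph_contains_AP k a _ D ha_incr nb0 D0) => j jk.
pose n := (n0 + b + j * D)%N; have n_gt0 : (0 < n)%N by rewrite /n; lia.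
have nE i : (n0 + b + (j + i) * D = n + i * D)%N by rewrite mulnDl addnA.
move: (nE 1%N) (nE 2%N); rewrite addn1 addn2 mul1n => -> ->; rewrite -/n.
apply: (@second_difference_eq0 K).
(* the three values of [R] lie in one cell *)
have colE i : (i < 3)%N -> M1 + (col (n0 + b)%N)%:R * h <= R (n + i * D)%N
    <= M1 + (col (n0 + b)%N)%:R * h + h.
  move=> i3; have -> : (n + i * D = n0 + (b + (j + i) * D))%N by rewrite /n; lia.
  by rewrite -(cD (j + i)%N); [apply: colP; lia|lia].
have nX : X < n%:R.
  by apply: lt_le_trans Xn0 _; rewrite ler_nat /n; lia.
have n0K : 0 < n%:R :> K by rewrite ltr0n.
have [||y /andP[ny _] fE] := @second_difference_MVT K f n%:R D%:R D0'.
- by move=> y /andP[ny _]; apply: hf1; lra.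
- by move=> y /andP[ny _]; apply: hf2; lra.
have := fX y (lt_trans nX ny).
rewrite !ha ?ltn_addr// [(n + 2 * D)%:R]natrD [(2 * D)%:R]natrM natrD.
move: (colE 0%N isT) (colE 1%N isT) (colE 2%N isT).
rewrite mul0n addn0 mul1n => /andP[l0 u0] /andP[l1 u1] /andP[l2 u2] fy.
have {}fy : `|(f^`(2))%classic y * D%:R ^+ 2| < e.
  rewrite normrM (ger0_norm (sqr_ge0 _)) mulrC; apply: lt_le_trans De.
  by rewrite ltr_pM2l// exprn_gt0.
rewrite ltr_norml -fE in fy; rewrite ltr_norml.
case/andP: fy => fy1 fy2; apply/andP; split; lra.
Qed.
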